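(* Let $G_S$ be a self-loop graph with $\sigma=|S|\ge1$ and loop vector $s$, and let $\widetilde G$ be its Açıkmeşe lift. For every $p>0$, $$\int_0^\infty e^{-pt}\chi_t^{\widetilde G}(g)\,dt=\frac{d}{dp}\log\big(p+2\sigma-2R_{G,S}(p)\big).$$ Moreover, for every $p>0$, $$\frac{\det(pI+M_{sym})}{\det(pI+\mathcal{L}(G_S))}=p+2\sigma-2\,s^\top(pI+\mathcal{L}(G_S))^{-1}s.$$
   Context: Let $G$ be a finite undirected simple graph with vertex set $V=\{1,\dots,N\}$ (possibly disconnected), and $S\subseteq V$. The self-loop graph $G_S$ is obtained from $G$ by attaching one loop at every vertex of $S$; $\sigma=|S|$. The loop vector $s\in\mathbb{R}^N$ is the indicator vector of $S$. $\mathcal{L}(G)=D(G)-A(G)$ is the ordinary Laplacian and $\mathcal{L}(G_S):=\mathcal{L}(G)+\mathrm{diag}(s)$, a positive semidefinite matrix. The loop resolvent is $R_{G,S}(p)=s^\top(pI+\mathcal{L}(G_S))^{-1}s$ for $p>0$. For $\sigma\ge1$, the Açıkmeşe lift $\widetilde G=(\widetilde V,\widetilde E)$ of $G_S$ is the simple graph on $\widetilde V=\{1,\dots,2N+1\}$ such that: for each edge $\{i,j\}$ of $G$, both $\{i,j\}$ and $\{i+N+1,j+N+1\}$ are edges of $\widetilde G$; for each $i\in S$, both $\{i,N+1\}$ and $\{N+1,i+N+1\}$ are edges; there are no other edges. $\mathcal{L}(\widetilde G)$ is the ordinary Laplacian of $\widetilde G$. The involution matrix $T$ is the $(2N+1)\times(2N+1)$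 permutation matrix of the map swapping $i\leftrightarrow i+N+1$ ($1\le i\le N$) and fixing $N+1$. For the nontrivial element $g$ of $\mathbb{Z}_2$, the equivariant heat character is $\chi_t^{\widetilde G}(g)=\mathrm{Tr}(e^{-t\mathcal{L}(\widetilde G)}T)$, $t>0$. $M_{sym}=\begin{pmatrix}2\sigma&-\sqrt2\,s^\top\\ -\sqrt2\,s&\mathcal{L}(G_S)\end{pmatrix}\in\mathbb{R}^{(N+1)\times(N+1)}$. *)

(* Defs.v *)
From HB Require Import structures.
From mathcomp Require Import all_boot all_order all_algebra perm zify.
From mathcomp Require Import all_classical all_reals all_analysis.

Set Implicit Arguments.
Unset Strict Implicit.
Unset Printing Implicit Defensive.

Import Order.TTheory GRing.Theory Num.Theory.
Import numFieldNormedType.Exports.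

Local Open Scope ring_scope.

(* A simple graph on n vertices is a symmetric irreflexive relation on 'I_n;
   vertices are numbered from 0. *)

Definition adjmx (R : realType) (n : nat) (e : rel 'I_n) : 'M[R]_n :=
  \matrix_(i, j) (e i j)%:R.

Definition degmx (R : realType) (n : nat) (e : rel 'I_n) : 'M[R]_n :=
  diag_mx (\row_i #|[set j | e i j]|%:R).

Definition laplacian (R : realType) (n : nat) (e : rel 'I_n) : 'M[R]_n :=
  degmx R e - adjmx R e.

Definition loopvec (R : realType) (n : nat) (S : {set 'I_n}) : 'cV[R]_n :=
  \col_i (i \in S)%:R.

Definition loop_laplacian (R : realType) (n : nat) (e : rel 'I_n)
    (S : {set 'I_n}) : 'M[R]_n :=
  laplacian R e + diag_mx (loopvec R S)^T.

Definition loop_resolvent (R : realType) (n : nat) (e : rel 'I_n)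
    (S : {set 'I_n}) (p : R) : R :=
  ((loopvec R S)^T *m invmx (p%:M + loop_laplacian R e S) *m loopvec R S) 0 0.

(* The 2n+1 vertices of the lift. With numbering from 0, lift_lo i, lift_mid n
   and lift_hi i have values i, n and i + n + 1. *)
Definition lift_lo (n : nat) (i : 'I_n) : 'I_(n + (1 + n)) := lshift (1 + n) i.
Definition lift_mid (n : nat) : 'I_(n + (1 + n)) := rshift n (lshift n ord0).
Definition lift_hi (n : nat) (i : 'I_n) : 'I_(n + (1 + n)) :=
  rshift n (rshift 1 i).

Definition lift (n : nat) (e : rel 'I_n) (S : {set 'I_n}) :
    rel 'I_(n + (1 + n)) := fun x y =>
  [exists i, exists j, e i j &&
     (((x == lift_lo i) && (y == lift_lo j))
      || ((x == lift_hi i) && (y == lift_hi j)))]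
  || [exists i in S,
     [|| (x == lift_lo i) && (y == lift_mid n),
         (x == lift_mid n) && (y == lift_lo i),
         (x == lift_mid n) && (y == lift_hi i) |
         (x == lift_hi i) && (y == lift_mid n)]].

Definition lift_swap (n : nat) (x : 'I_(n + (1 + n))) : 'I_(n + (1 + n)) :=
  match fintype.split x with
  | inl i => lift_hi i
  | inr y => match fintype.split y with
             | inl _ => lift_mid n
             | inr i => lift_lo i
             end
  end.

Lemma lift_swapK (n : nat) : involutive (@lift_swap n).
Proof.
have lo (i : 'I_n) : lift_swap (lift_lo i) = lift_hi i.
  by rewrite /lift_swap (unsplitK (inl _ i)).
have hi (i : 'I_n) : lift_swap (lift_hi i) = lift_lo i.
  by rewrite /lift_swap (unsplitK (inr _ (rshift 1 i))) (unsplitK (inr _ i)).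
have mid : lift_swap (lift_mid n) = lift_mid n.
  by rewrite /lift_swap (unsplitK (inr _ (lshift n ord0))) (unsplitK (inl _ ord0)).
move=> x; rewrite {2}/lift_swap -{2}(splitK x).
case: (fintype.split x) => [i|y] /=; first by rewrite hi.
rewrite -{2}(splitK y); case: (fintype.split y) => [i|i] /=; last by rewrite lo.
by rewrite mid (ord1 i).
Qed.

Definition lift_perm_swap (n : nat) : 'S_(n + (1 + n)) :=
  perm (inv_inj (@lift_swapK n)).

Definition involution_mx (R : realType) (n : nat) : 'M[R]_(n + (1 + n)) :=
  perm_mx (lift_perm_swap n).

(* Entrywise sum of the exponential series. *)
Definition expmx (R : realType) (n : nat) (A : 'M[R]_n) : 'M[R]_n :=
  \matrix_(i, j) limn (series (fun k : nat => ((k`!%:R)^-1 *: A ^+ k) i j)).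

Definition heat_character (R : realType) (n : nat) (e : rel 'I_n)
    (S : {set 'I_n}) (t : R) : R :=
  \tr (expmx (- t *: laplacian R (lift e S)) *m involution_mx R n).

Definition Msym (R : realType) (n : nat) (e : rel 'I_n) (S : {set 'I_n}) :
    'M[R]_(1 + n) :=
  block_mx (2 * #|S|%:R)%:M (- (Num.sqrt 2 *: (loopvec R S)^T))
           (- (Num.sqrt 2 *: loopvec R S)) (loop_laplacian R e S).

Lemma lift_sym (n : nat) (e : rel 'I_n) (S : {set 'I_n}) :
  symmetric e -> symmetric (lift e S).
Proof.
move=> es; suff H x y : lift e S x y -> lift e S y x.
  by move=> x y; apply/idP/idP; exact: H.
case/orP.
  move=> /existsP[i /existsP[j /andP[eij h]]]; apply/orP; left.
  apply/existsP; exists j; apply/existsP; exists i; rewrite es eij /=.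
  by case/orP: h => /andP[-> ->]; rewrite ?orbT.
move=> /existsP[i /andP[iS h]]; apply/orP; right; apply/existsP; exists i.
by rewrite iS /=; case/or4P: h => /andP[-> ->]; rewrite ?orbT.
Qed.

Lemma lift_irr (n : nat) (e : rel 'I_n) (S : {set 'I_n}) :
  irreflexive e -> irreflexive (lift e S).
Proof.
move=> ei x; apply/negP => /orP[].
  move=> /existsP[i /existsP[j /andP[eij]]].
  by case/orP => /andP[/eqP-> /eqP] => [/lshift_inj|/rshift_inj/rshift_inj] ij;
     rewrite ij ei in eij.
move=> /existsP[i /andP[_]].
have [vl vm vh] : [/\ lift_lo i = i :> nat, lift_mid n = n :> nat
    & lift_hi i = (n + i.+1)%N :> nat] by rewrite /= addn0.
have ltin := ltn_ord i.
by case/or4P => /andP[/eqP-> /eqP/(congr1 val)];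
  rewrite /= -?[X in X = _]/(nat_of_ord _) ?vl ?vm ?vh => h; lia.
Qed.

(* Main.v *)
Require Import Defs.
From HB Require Import structures.
From mathcomp Require Import all_boot all_order all_algebra perm.
From mathcomp Require Import all_classical all_reals all_analysis.
From mathcomp Require Import complex ring.
Import Order.TTheory GRing.Theory Num.Theory.
Import numFieldNormedType.Exports.
Local Open Scope classical_set_scope.
Local Open Scope ring_scope.

Set Implicit Arguments.
Unset Strict Implicit.

(** Let [L] be the Laplacian of the lift, [T] the swap matrix, [Lam] the
    Laplacian of the self-loop graph.  [T] commutes with [L] and is an
    involution, so the space of functions on the vertices of the lift splits
    into the even functions, which [T] fixes, and the odd ones, which it negates.
    In the orthonormal bases given by the rows of [even_sector] and [odd_sector],
    [L] acts as [Msym] on the even part and as [Lam] on the odd part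
    ([even_laplacian], [odd_laplacian]).  Hence
    [tr (L ^ k T) = tr (Msym ^ k) - tr (Lam ^ k)] for every [k]
    ([trace_lift_swap]).

    Both [Msym] and [Lam] are compressions of [L], which is symmetric and positive
    semidefinite; by the spectral theorem they have real spectra [mu] and [nu],
    with nonnegative entries ([compression_spectrum]).  Summing the exponential
    series gives the heat character as [sum_i exp (- t mu_i) - sum_i exp (- t nu_i)]
    ([heat_character_spectral]), and its Laplace transform at [p] is
    [sum_i 1 / (p + mu_i) - sum_i 1 / (p + nu_i)] ([laplace_exp_sum]).

    That is the logarithmic derivative of
    [prod_i (q + mu_i) / prod_i (q + nu_i) = det (q + Msym) / det (q + Lam)]
    at [q = p] ([is_derive_ln_prod]), and by the Schur complement of the block
    [q + Lam] this quotient of determinants is [F q = q + 2 sigma - 2 R(q)]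
    ([det_Msym_ratio]).  Since the quotient only involves positive factors, the
    invertibility of [p + Lam] and the positivity of [F p] follow. *)

(** * Spectra of real symmetric matrices *)

Lemma trace_det_similar_diag (K : fieldType) (n : nat) (A P : 'M[K]_n)
    (d : 'rV[K]_n) (Pu : P \in unitmx) (AE : A = invmx P *m diag_mx d *m P) :
  (forall k, \tr (A ^+ k) = \sum_i d 0 i ^+ k) /\
  (forall q, \det (q%:M + A) = \prod_i (q + d 0 i)).
Proof.
split=> [k|q].
  have -> : A ^+ k = invmx P *m diag_mx (\row_i d 0 i ^+ k) *m P.
    elim: k => [|k IH].
      have -> : \row_i d 0 i ^+ 0 = const_mx 1 by apply/rowP => i; rewrite !mxE.
      by rewrite diag_const_mx mulmx1 mulVmx.
    rewrite exprS IH [in LHS]AE -mulmxE !mulmxA mulmxK //.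
    rewrite -[_ *m _ *m diag_mx _]mulmxA mulmx_diag.
    by congr (_ *m diag_mx _ *m _); apply/rowP => i; rewrite !mxE exprS.
  rewrite mxtrace_mulC mulmxA mulmxV // mul1mx mxtrace_diag.
  by apply: eq_bigr => i _; rewrite mxE.
have -> : q%:M + A = invmx P *m diag_mx (\row_i (q + d 0 i)) *m P.
  have -> : \row_i (q + d 0 i) = const_mx q + d by apply/rowP => i; rewrite !mxE.
  rewrite [diag_mx _]raddfD /= diag_const_mx mulmxDr mulmxDl -AE; congr (_ + _).
  by rewrite scalar_mxC -mulmxA mulVmx // mulmx1.
rewrite !det_mulmx mulrAC -det_mulmx mulVmx // det1 mul1r det_diag.
by apply: eq_bigr => i _; rewrite mxE.
Qed.

(** A real symmetric matrix is Hermitian as a complex matrix, so the complex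
    spectral theorem applies and yields real eigenvalues.  Only the power traces
    and the characteristic polynomial are recorded, because these are invariant
    under the complex change of basis and so descend to the reals. *)
Lemma symmetric_spectrum (R : rcfType) (n : nat) (A : 'M[R]_n) (sA : A^T = A) :
  exists l : 'I_n -> R,
    (forall k, \tr (A ^+ k) = \sum_i l i ^+ k) /\
    (forall q, \det (q%:M + A) = \prod_i (q + l i)).
Proof.
pose f : {rmorphism R -> R[i]} := real_complex R.
pose B := map_mx f A.
have hB : B \is hermsymmx.
  apply: realsym_hermsym.
    by apply/is_hermitianmxP; rewrite expr0 scale1r map_mx_id // map_trmx sA.
  by apply/mxOverP => i j; rewrite mxE; apply/complex_realP; exists (A i j).
have [tB dB] := trace_det_similar_diag (spectral_unit B)
  (orthomx_spectralP (hermitian_normalmx hB)).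
have lE i : f (complex.Re (spectral_diag B 0 i)) = spectral_diag B 0 i.
  by apply/RRe_real; exact: (mxOverP (hermitian_spectral_diag_real hB)).
exists (fun i => complex.Re (spectral_diag B 0 i)); split=> [k|q].
  apply: (fmorph_inj f); rewrite -trace_map_mx rmorph_sum /=.
  have -> : map_mx f (A ^+ k) = B ^+ k.
    elim: k => [|k IH]; first by rewrite !expr0 map_mx1.
    by rewrite !exprS map_mxM IH.
  by rewrite tB; apply: eq_bigr => i _; rewrite rmorphXn /= lE.
apply: (fmorph_inj f); rewrite -det_map_mx map_mxD map_scalar_mx dB rmorph_prod.
by apply: eq_bigr => i _; rewrite rmorphD /= lE.
Qed.

(** If some [l i] were negative, [- l i + A] would be singular; but it is positive
    definite.  Arguing with the determinant keeps the eigenvector real. *)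
Lemma psd_spectrum_ge0 (R : realFieldType) (n : nat) (A : 'M[R]_n)
    (psdA : forall v : 'rV[R]_n, 0 <= (v *m A *m v^T) 0 0) (l : 'I_n -> R)
    (detA : forall q, \det (q%:M + A) = \prod_i (q + l i)) (i : 'I_n) :
  0 <= l i.
Proof.
rewrite leNgt; apply/negP => li_lt0.
have /eqP/det0P[v v_neq0 vE] : \det ((- l i)%:M + A) = 0.
  by rewrite detA (bigD1 i) //= addNr mul0r.
have v2_gt0 : 0 < (v *m v^T) 0 0.
  rewrite mxE; have [j vj] := rV0Pn _ v_neq0.
  rewrite (bigD1 j) //= ltr_pwDl //.
    by rewrite mxE -expr2 exprn_even_gt0.
  by apply: sumr_ge0 => m _; rewrite mxE -expr2 sqr_ge0.
have /eqP : - l i * (v *m v^T) 0 0 + (v *m A *m v^T) 0 0 = 0.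
  have /(congr1 (fun w => (w *m v^T) 0 0)) := vE.
  rewrite mulmxDr mulmxDl mul0mx mul_mx_scalar -scalemxAl.
  by rewrite [in LHS]mxE [X in X + _]mxE [in RHS]mxE.
by rewrite gt_eqF // ltr_pwDl // mulr_gt0 // oppr_gt0.
Qed.

(** * The Laplacian of the lift in block form *)

Lemma eq_lift_vertex (n : nat) :
  [/\ (forall i j : 'I_n, (lift_lo i == lift_lo j) = (i == j)),
      (forall i j : 'I_n, (lift_hi i == lift_hi j) = (i == j)),
      (forall i j : 'I_n, (lift_lo i == lift_hi j) = false) &
      (forall i j : 'I_n, (lift_hi i == lift_lo j) = false)] /\
  [/\ (forall i : 'I_n, (lift_lo i == lift_mid n) = false),
      (forall i : 'I_n, (lift_mid n == lift_lo i) = false),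
      (forall i : 'I_n, (lift_hi i == lift_mid n) = false) &
      (forall i : 'I_n, (lift_mid n == lift_hi i) = false)].
Proof.
by split; split => *; rewrite /lift_lo /lift_hi /lift_mid
  ?(eq_lshift, eq_rshift, eq_lrshift, eq_rlshift).
Qed.

Lemma lift_edgeE (n : nat) (e : rel 'I_n) (S : {set 'I_n}) :
  [/\ (forall i j, Defs.lift e S (lift_lo i) (lift_lo j) = e i j),
      (forall i j, Defs.lift e S (lift_hi i) (lift_hi j) = e i j),
      (forall i j, Defs.lift e S (lift_lo i) (lift_hi j) = false) &
      (forall i j, Defs.lift e S (lift_hi i) (lift_lo j) = false)] /\
  [/\ (forall i, Defs.lift e S (lift_lo i) (lift_mid n) = (i \in S)),
      (forall i, Defs.lift e S (lift_mid n) (lift_lo i) = (i \in S)),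
      (forall i, Defs.lift e S (lift_hi i) (lift_mid n) = (i \in S)),
      (forall i, Defs.lift e S (lift_mid n) (lift_hi i) = (i \in S)) &
      Defs.lift e S (lift_mid n) (lift_mid n) = false].
Proof.
have [[ll hh lh hl] [lm ml hm mh]] := eq_lift_vertex n.
have Dm : (lift_mid n == lift_mid n) = true by rewrite eqxx.
have D := (ll, hh, lh, hl, (lm, ml, hm, mh), Dm).
split; split; intros; rewrite /Defs.lift; first
  [ apply/negbTE/negP => /orP[/existsP[a /existsP[b]]|/existsP[a]]
  | apply/idP/idP => [/orP[/existsP[a /existsP[b]]|/existsP[a]]|]].
all: rewrite ?D ?andbF ?andbT ?orbF ?andbF ?orbT //.
all: try by move=> /andP[eab /andP[/eqP-> /eqP->]].
all: try by move=> /andP[aS /eqP->].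
all: move=> h.
(* Only genuine edges are left: inside a copy of the graph, or at the middle vertex. *)
all: try (apply/orP; left; apply/existsP; exists i; apply/existsP; exists j;
  by rewrite !D !eqxx h ?orbT).
all: by apply/orP; right; apply/existsP; exists i; rewrite !D !eqxx h ?orbT.
Qed.

Section LiftMatrices.
Variables (R : realType).

Lemma natr_card_sum (n : nat) (A : {set 'I_n}) : #|A|%:R = \sum_i (i \in A)%:R :> R.
Proof.
rewrite -sum1_card natr_sum /= big_mkcond /=; apply: eq_bigr => i _.
by case: (i \in A).
Qed.

Lemma laplacianE (n : nat) (e : rel 'I_n) (i j : 'I_n) :
  laplacian R e i j = (\sum_k (e i k)%:R) *+ (i == j) - (e i j)%:R.
Proof.
rewrite !mxE natr_card_sum; congr (_ *+ _ - _).
by apply: eq_bigr => k _; rewrite inE.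
Qed.

Lemma loop_laplacianE (n : nat) (e : rel 'I_n) (S : {set 'I_n}) (i j : 'I_n) :
  loop_laplacian R e S i j =
  (\sum_k (e i k)%:R + (i \in S)%:R) *+ (i == j) - (e i j)%:R.
Proof. by rewrite mxE laplacianE !mxE mulrnDl addrAC. Qed.

Lemma sum_lift_vertex (n : nat) (f : 'I_(n + (1 + n)) -> R) :
  \sum_x f x = \sum_i f (lift_lo i) + (f (lift_mid n) + \sum_i f (lift_hi i)).
Proof. by rewrite big_split_ord /= big_split_ord /= big_ord1. Qed.

Lemma sum0b (n : nat) (f : 'I_n -> bool) (f0 : forall i, f i = false) :
  \sum_i (f i)%:R = 0 :> R.
Proof. by apply: big1 => i _; rewrite f0. Qed.

Lemma laplacian_lift (n : nat) (e : rel 'I_n) (S : {set 'I_n}) :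
  laplacian R (Defs.lift e S) =
  block_mx (loop_laplacian R e S) (row_mx (- loopvec R S) 0)
    (col_mx (- (loopvec R S)^T) 0)
    (block_mx (2 * #|S|%:R)%:M (- (loopvec R S)^T)
              (- loopvec R S) (loop_laplacian R e S)).
Proof.
have [[ll hh lh hl] [lm ml hm mh mm]] := lift_edgeE e S.
have [[dll dhh dlh dhl] [dlm dml dhm dmh]] := eq_lift_vertex n.
have deg_lo i : \sum_x (Defs.lift e S (lift_lo i) x)%:R =
    \sum_k (e i k)%:R + (i \in S)%:R :> R.
  rewrite sum_lift_vertex lm (sum0b (lh i)) addr0.
  by under eq_bigr do rewrite ll.
have deg_hi i : \sum_x (Defs.lift e S (lift_hi i) x)%:R =
    \sum_k (e i k)%:R + (i \in S)%:R :> R.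
  rewrite sum_lift_vertex hm (sum0b (hl i)) add0r addrC.
  by under eq_bigr do rewrite hh.
have deg_mid : \sum_x (Defs.lift e S (lift_mid n) x)%:R = 2 * #|S|%:R :> R.
  rewrite sum_lift_vertex mm add0r natr_card_sum mulr_natl mulr2n.
  by congr (_ + _); apply: eq_bigr => i _; rewrite ?ml ?mh.
apply/matrixP => x y; rewrite laplacianE.
case: (split_ordP x) => [i|x'] ->.
  rewrite -[lshift _ i]/(lift_lo i) deg_lo.
  case: (split_ordP y) => [j|y'] ->.
    rewrite -[lshift _ j]/(lift_lo j).
    by rewrite dll ll block_mxEul loop_laplacianE.
  rewrite block_mxEur; case: (split_ordP y') => [j|j] ->.
    rewrite (ord1 j) -[rshift _ _]/(lift_mid n).
    by rewrite dlm lm row_mxEl !mxE sub0r.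
  rewrite -[rshift _ _]/(lift_hi j).
  by rewrite dlh lh row_mxEr mxE subr0.
case: (split_ordP x') => [i|i] ->.
  rewrite (ord1 i) -[rshift _ _]/(lift_mid n) deg_mid.
  case: (split_ordP y) => [j|y'] ->.
    rewrite -[lshift _ j]/(lift_lo j).
    by rewrite dml ml block_mxEdl col_mxEu !mxE sub0r.
  rewrite block_mxEdr; case: (split_ordP y') => [j|j] ->.
    rewrite (ord1 j) -[rshift _ _]/(lift_mid n).
    by rewrite eqxx mm block_mxEul mxE subr0 eqxx.
  rewrite -[rshift _ _]/(lift_hi j).
  by rewrite dmh mh block_mxEur !mxE sub0r.
rewrite -[rshift _ _]/(lift_hi i) deg_hi.
case: (split_ordP y) => [j|y'] ->.
  rewrite -[lshift _ j]/(lift_lo j).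
  by rewrite dhl hl block_mxEdl col_mxEd mxE subr0.
rewrite block_mxEdr; case: (split_ordP y') => [j|j] ->.
  rewrite (ord1 j) -[rshift _ _]/(lift_mid n).
  by rewrite dhm hm block_mxEdl !mxE sub0r.
rewrite -[rshift _ _]/(lift_hi j).
by rewrite dhh hh block_mxEdr loop_laplacianE.
Qed.

Lemma involution_mxE (n : nat) :
  involution_mx R n =
  block_mx 0 (row_mx 0 1%:M) (col_mx 0 1%:M) (block_mx 1%:M 0 0 0).
Proof.
have [[dll dhh dlh dhl] [dlm dml dhm dmh]] := eq_lift_vertex n.
have swap_lo (i : 'I_n) : lift_swap (lift_lo i) = lift_hi i.
  by rewrite /lift_swap (unsplitK (inl _ i)).
have swap_hi (i : 'I_n) : lift_swap (lift_hi i) = lift_lo i.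
  by rewrite -swap_lo lift_swapK.
have swap_mid : lift_swap (lift_mid n) = lift_mid n.
  by rewrite /lift_swap (unsplitK (inr _ (lshift n ord0))) (unsplitK (inl _ ord0)).
have TE x y : involution_mx R n x y = (lift_swap x == y)%:R.
  by rewrite !mxE permE.
apply/matrixP => x y; rewrite TE.
case: (split_ordP x) => [i|x'] ->; last case: (split_ordP x') => [i|i] ->.
all: rewrite ?(ord1 i) -?[lshift _ i]/(lift_lo i) -?[rshift _ (lshift _ _)]/(lift_mid n)
    -?[rshift _ (rshift _ _)]/(lift_hi i) ?swap_lo ?swap_hi ?swap_mid.
all: case: (split_ordP y) => [j|y'] ->; last case: (split_ordP y') => [j|j] ->.
all: rewrite ?(ord1 j) -?[lshift _ j]/(lift_lo j) -?[rshift _ (lshift _ _)]/(lift_mid n)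
    -?[rshift _ (rshift _ _)]/(lift_hi j) ?dll ?dhh ?dlh ?dhl ?dlm ?dml ?dhm ?dmh ?eqxx.
all: rewrite ?(block_mxEul, block_mxEur, block_mxEdl, block_mxEdr,
    row_mxEl, row_mxEr, col_mxEu, col_mxEd) ?mxE ?eqxx //.
Qed.
End LiftMatrices.

(** * Even and odd sectors *)

Lemma laplacian_tr (R : realType) (n : nat) (e : rel 'I_n) (e_sym : symmetric e) :
  (laplacian R e)^T = laplacian R e.
Proof.
apply/matrixP => i j; rewrite mxE !laplacianE (e_sym j i) eq_sym.
by case: eqP => [->|].
Qed.

(** The quadratic form is half of the sum of [(v i - v j) ^ 2] over ordered pairs of
    adjacent vertices. *)
Lemma laplacian_psd (R : realType) (n : nat) (e : rel 'I_n)
    (e_sym : symmetric e) (v : 'rV[R]_n) :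
  0 <= (v *m laplacian R e *m v^T) 0 0.
Proof.
pose Q := \sum_i \sum_j (e i j)%:R * (v 0 i ^+ 2 - v 0 i * v 0 j).
have -> : (v *m laplacian R e *m v^T) 0 0 = Q.
  rewrite mxE; under eq_bigr => j _ do rewrite !mxE mulr_suml.
  rewrite exchange_big /=; apply: eq_bigr => i _.
  under eq_bigr => j _ do rewrite laplacianE mulrBr mulrBl.
  under [RHS]eq_bigr => j _ do rewrite mulrBr.
  rewrite !sumrB; congr (_ - _); last first.
    by apply: eq_bigr => j _; rewrite mulrAC mulrC mulrA.
  rewrite (bigD1 i) //= eqxx mulr1n [X in _ + X]big1 ?addr0; last first.
    by move=> j ji; rewrite eq_sym (negbTE ji) mulr0n mulr0 mul0r.
  by rewrite -mulr_suml mulrAC -expr2 mulrC.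
have Q2 : Q + Q = \sum_i \sum_j (e i j)%:R * (v 0 i - v 0 j) ^+ 2.
  rewrite [X in _ + X]exchange_big -big_split /=; apply: eq_bigr => i _.
  rewrite -big_split /=; apply: eq_bigr => j _; rewrite (e_sym j i); ring.
have : 0 <= Q + Q.
  rewrite Q2; apply: sumr_ge0 => i _; apply: sumr_ge0 => j _.
  by rewrite mulr_ge0 ?ler0n ?sqr_ge0.
by rewrite -mulr2n pmulrn_lge0.
Qed.

Section Sectors.
Variables (R : realType) (n : nat).
Let c : R := (Num.sqrt 2)^-1.

(** An orthonormal basis of the functions fixed by the swap, as rows: the
    middle vertex, then [(lo i + hi i) / sqrt 2] for each [i]. *)
Definition even_sector : 'M[R]_(1 + n, n + (1 + n)) :=
  block_mx 0 (row_mx 1%:M 0) c%:M (row_mx 0 c%:M).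

(** An orthonormal basis of the functions negated by the swap, as rows:
    [(lo i - hi i) / sqrt 2]. *)
Definition odd_sector : 'M[R]_(n, n + (1 + n)) :=
  row_mx c%:M (row_mx 0 (- c%:M)).

Lemma sqrt2_gt0 : 0 < Num.sqrt 2 :> R. Proof. by rewrite sqrtr_gt0. Qed.

Lemma invsqrt2_sqrD : c * c + c * c = 1.
Proof.
by rewrite /c -invfM -expr2 sqr_sqrtr //; field.
Qed.

Lemma invsqrt2D : c + c = Num.sqrt 2.
Proof.
apply: (@mulIf _ c); first by rewrite invr_eq0 gt_eqF ?sqrt2_gt0.
by rewrite mulrDl invsqrt2_sqrD mulfV // gt_eqF ?sqrt2_gt0.
Qed.

Let scM (m : nat) (a b : R) : a%:M *m b%:M = (a * b)%:M :> 'M[R]_m.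
Proof. by rewrite -scalar_mxM. Qed.

Lemma even_swap : even_sector *m involution_mx R n = even_sector.
Proof.
rewrite involution_mxE /even_sector mulmx_block !mul_row_block !mul_row_col.
rewrite !(mul0mx, mulmx0, mul1mx, mulmx1, add0r, addr0, row_mx0).
by rewrite mul_mx_row !(mulmx0, mulmx1).
Qed.

Lemma odd_swap : odd_sector *m involution_mx R n = - odd_sector.
Proof.
rewrite involution_mxE /odd_sector mul_row_block !mul_row_block !mul_row_col.
rewrite !(mul0mx, mulmx0, mul1mx, mulmx1, add0r, addr0) mul_mx_row !(mulmx0, mulmx1).
by rewrite row_mx0 addr0 !opp_row_mx oppr0 opprK.
Qed.

Lemma even_orthonormal : even_sector *m even_sector^T = 1%:M.
Proof.
rewrite /even_sector tr_block_mx !tr_row_mx mulmx_block !mul_row_col.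
rewrite !tr_scalar_mx !trmx0 !(mul0mx, mulmx0, mul1mx, add0r, addr0).
by rewrite !scM -raddfD /= invsqrt2_sqrD -scalar_mx_block.
Qed.

Lemma odd_orthonormal : odd_sector *m odd_sector^T = 1%:M.
Proof.
rewrite /odd_sector !tr_row_mx !mul_row_col !tr_scalar_mx trmx0.
by rewrite linearN /= tr_scalar_mx mulNmx mulmxN opprK
  mul0mx add0r !scM -raddfD /= invsqrt2_sqrD.
Qed.

Lemma sectors_span :
  even_sector^T *m even_sector + odd_sector^T *m odd_sector = 1%:M.
Proof.
rewrite /even_sector /odd_sector tr_block_mx !tr_row_mx !tr_scalar_mx !trmx0.
rewrite mulmx_block mul_col_row !mul_col_row !mul_mx_row !mul_col_mx.
rewrite !(mul0mx, mulmx0, mul1mx, mulmx1, add0r, addr0, linearN) /= ?tr_scalar_mx.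
rewrite !(mulNmx, mulmxN) !scM ?opprK.
rewrite !add_block_mx !(add_row_mx, add_col_mx) !(add0r, addr0) -?raddfD /= invsqrt2_sqrD.
by rewrite !addrN row_mx0 col_mx0 -!scalar_mx_block.
Qed.

Variables (e : rel 'I_n) (S : {set 'I_n}).

(** Looped vertices are joined to the middle in both copies; the two edges add up
    to the entry [- 2 / sqrt 2 = - sqrt 2] of [Msym]. *)
Lemma even_laplacian :
  even_sector *m laplacian R (Defs.lift e S) = Msym R e S *m even_sector.
Proof.
rewrite laplacian_lift /even_sector /Msym !mulmx_block !mul_row_block.
rewrite !mul_row_col !mul_mx_row.
rewrite !(mul0mx, mulmx0, mul1mx, mulmx1, add0r, addr0, row_mx0) add_row_mx !(add0r, addr0).
rewrite !mul_scalar_mx !mul_mx_scalar !scalerN.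
rewrite !scalerA mulVf ?gt_eqF ?sqrt2_gt0 // scale1r.
rewrite !add_row_mx !(addr0, add0r).
by rewrite -opprD -scalerDl invsqrt2D.
Qed.

(** An odd function vanishes at the middle vertex, which thus acts only through
    the degrees: it leaves the diagonal term that a loop contributes. *)
Lemma odd_laplacian :
  odd_sector *m laplacian R (Defs.lift e S) = loop_laplacian R e S *m odd_sector.
Proof.
rewrite laplacian_lift /odd_sector mul_row_block !mul_mx_row !mul_row_block !mul_row_col.
rewrite !(mul0mx, mulmx0, mul1mx, mulmx1, add0r, addr0) add_row_mx !(add0r, addr0).
by rewrite mulmxN mulNmx mulmxN opprK addNr mulNmx mulmxN -scalar_mxC.
Qed.
End Sectors.

Lemma intertwine_exp (K : pzSemiRingType) (m m' : nat) (A : 'M[K]_m) (B : 'M[K]_m')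
    (Q : 'M[K]_(m, m'))
    (AQ : Q *m B = A *m Q) (k : nat) : Q *m B ^+ k = A ^+ k *m Q.
Proof.
elim: k => [|k IH]; first by rewrite !expr0 mulmx1 mul1mx.
by rewrite !exprSr mulmxA IH -mulmxA AQ mulmxA.
Qed.

Section Spectra.
Variables (R : realType) (n : nat) (e : rel 'I_n) (S : {set 'I_n}).
Let L := laplacian R (Defs.lift e S).

(** Split the trace along the two sectors: the swap acts as [1] on the even one and
    as [-1] on the odd one. *)
Lemma trace_lift_swap (k : nat) :
  \tr (L ^+ k *m involution_mx R n) =
  \tr (Msym R e S ^+ k) - \tr (loop_laplacian R e S ^+ k).
Proof.
pose X := L ^+ k *m involution_mx R n.
have cyc (m : nat) (Q : 'M[R]_(m, n + (1 + n))) :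
    \tr (X *m (Q^T *m Q)) = \tr (Q *m L ^+ k *m involution_mx R n *m Q^T).
  by rewrite mulmxA mxtrace_mulC /X !mulmxA.
rewrite -[LHS]/(\tr X) -[X]mulmx1 -(sectors_span R n) mulmxDr raddfD /= !cyc.
rewrite (intertwine_exp (even_laplacian R e S)).
rewrite (intertwine_exp (odd_laplacian R e S)).
rewrite -(mulmxA (Msym R e S ^+ k)) even_swap.
rewrite -(mulmxA (loop_laplacian R e S ^+ k)) odd_swap mulmxN mulNmx.
by rewrite -!mulmxA even_orthonormal odd_orthonormal !mulmx1 raddfN.
Qed.

Lemma Msym_compression :
  Msym R e S = even_sector R n *m L *m (even_sector R n)^T.
Proof. by rewrite even_laplacian -mulmxA even_orthonormal mulmx1. Qed.

Lemma loop_laplacian_compression :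
  loop_laplacian R e S = odd_sector R n *m L *m (odd_sector R n)^T.
Proof. by rewrite odd_laplacian -mulmxA odd_orthonormal mulmx1. Qed.

(** Used for the two sectors: symmetry and positivity are inherited from the
    Laplacian of the lift. *)
Lemma compression_spectrum (m : nat) (Q : 'M[R]_(m, n + (1 + n))) (A : 'M[R]_m)
    (e_sym : symmetric e) (AE : A = Q *m L *m Q^T) :
  exists l : 'I_m -> R, [/\ forall i, 0 <= l i,
    forall k, \tr (A ^+ k) = \sum_i l i ^+ k &
    forall q, \det (q%:M + A) = \prod_i (q + l i)].
Proof.
have L_sym := lift_sym S e_sym.
have [|l [trA detA]] := @symmetric_spectrum R m A.
  by rewrite AE !trmx_mul trmxK laplacian_tr // mulmxA.
exists l; split=> // i; apply: (psd_spectrum_ge0 _ detA) => v.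
by have := laplacian_psd L_sym (v *m Q); rewrite AE trmx_mul !mulmxA.
Qed.

End Spectra.

(** * Schur complement *)

Lemma det_schur_complement (K : fieldType) (n : nat) (a : K) (u : 'rV[K]_n)
    (w : 'cV[K]_n) (B : 'M[K]_n) (Bu : B \in unitmx) :
  \det (block_mx a%:M u w B) = (a - (u *m invmx B *m w) 0 0) * \det B.
Proof.
have -> : block_mx a%:M u w B =
    block_mx 1%:M (u *m invmx B) 0 1%:M *m
    block_mx (a%:M - u *m invmx B *m w) 0 w B.
  rewrite mulmx_block !(mul1mx, mul0mx, mulmx0, add0r) mulmxKV //.
  by rewrite subrK.
rewrite det_mulmx det_ublock det_lblock !det1 !mul1r; congr (_ * _).
by rewrite det_mx11 !mxE mulr1n.
Qed.

Lemma det_Msym_ratio (R : realType) (n : nat) (e : rel 'I_n) (S : {set 'I_n}) (q : R)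
    (u : q%:M + loop_laplacian R e S \in unitmx) :
  \det (q%:M + Msym R e S) / \det (q%:M + loop_laplacian R e S) =
  q + 2 * #|S|%:R - 2 * loop_resolvent e S q.
Proof.
have sq2 : Num.sqrt 2 * Num.sqrt 2 = 2 :> R by rewrite -expr2 sqr_sqrtr.
rewrite scalar_mx_block add_block_mx !add0r -raddfD /= det_schur_complement //.
rewrite mulfK; last by rewrite -unitfE -unitmxE.
congr (_ - _); rewrite mulNmx mulNmx mulmxN opprK -!scalemxAl -scalemxAr scalerA.
by rewrite mxE sq2.
Qed.

(** * The heat character as a sum of exponentials *)

Section ExponentialSeries.
Variable (R : realType).

Lemma cvg_series_sum (I : Type) (r : seq I) (f : I -> nat -> R) (a : I -> R)
    (fa : forall i, series (f i) @ \oo --> a i) :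
  series (fun k => \sum_(i <- r) f i k) @ \oo --> \sum_(i <- r) a i.
Proof.
have -> : series (fun k => \sum_(i <- r) f i k) =
    (fun m => \sum_(i <- r) series (f i) m).
  by apply/funext => m; rewrite /series /= exchange_big.
by apply: (@cvg_big _ _ +%R 0) => //; exact: add_continuous.
Qed.

Lemma cvg_series_scale (c : R) (f : nat -> R) (a : R) (fa : series f @ \oo --> a) :
  series (fun k => c * f k) @ \oo --> c * a.
Proof.
have -> : series (fun k => c * f k) = (fun m => c * series f m).
  by apply/funext => m; rewrite /series /= mulr_sumr.
by apply: cvgM; [exact: cvg_cst | exact: fa].
Qed.

(** The sum of the absolute values of the entries dominates the maximal absolute
    row sum, an operator norm; it serves to compare with a scalar exponential. *)
Lemma normr_mx_exp_entry (m : nat) (A : 'M[R]_m) (k : nat) (i j : 'I_m) :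
  `|(A ^+ k) i j| <= (\sum_i \sum_j `|A i j|) ^+ k.
Proof.
elim: k i j => [|k IH] i j.
  by rewrite !expr0 mxE; case: (i == j); rewrite ?normr1 ?normr0 ?ler01.
have s_ge0 : 0 <= \sum_i \sum_j `|A i j|.
  by apply: sumr_ge0 => ? _; apply: sumr_ge0 => ? _.
rewrite !exprS mxE; apply: le_trans (ler_norm_sum _ _ _) _.
under eq_bigr do rewrite normrM.
apply: (@le_trans _ _ (\sum_l `|A i l| * (\sum_i \sum_j `|A i j|) ^+ k)).
  by apply: ler_sum => l _; rewrite ler_wpM2l.
rewrite -mulr_suml ler_wpM2r ?exprn_ge0 //.
rewrite [leRHS](bigD1 i) //= lerDl; apply: sumr_ge0 => ? _.
by apply: sumr_ge0 => ? _.
Qed.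

Lemma cvg_expmx_entry (m : nat) (A : 'M[R]_m) (i j : 'I_m) :
  series (fun k => (k`!%:R)^-1 * (A ^+ k) i j) @ \oo --> expmx A i j.
Proof.
suff : cvgn (series (fun k => (k`!%:R)^-1 * (A ^+ k) i j)).
  have scaleE : (fun k => ((k`!%:R)^-1 *: A ^+ k) i j) =
      (fun k => (k`!%:R)^-1 * (A ^+ k) i j) by apply/funext => k; rewrite mxE.
  by rewrite mxE scaleE.
apply: normed_cvg.
apply: series_le_cvg (is_cvg_series_exp_coeff (\sum_i \sum_j `|A i j|)) => k //=.
  by rewrite exp_coeff_ge0 //; do 2!apply: sumr_ge0 => ? _.
rewrite normrM ger0_norm ?invr_ge0 ?ler0n // mulrC.
by rewrite ler_wpM2r ?invr_ge0 ?ler0n // normr_mx_exp_entry.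
Qed.

Lemma cvg_trace_expmx (m : nat) (A B : 'M[R]_m) :
  series (fun k => (k`!%:R)^-1 * \tr (A ^+ k *m B)) @ \oo --> \tr (expmx A *m B).
Proof.
have -> : (fun k => (k`!%:R)^-1 * \tr (A ^+ k *m B)) =
    (fun k => \sum_i \sum_j B j i * ((k`!%:R)^-1 * (A ^+ k) i j)).
  apply/funext => k; rewrite mulr_sumr; apply: eq_bigr => i _.
  rewrite mxE mulr_sumr; apply: eq_bigr => j _.
  by rewrite [RHS]mulrC mulrA.
apply: cvg_series_sum => i; rewrite mxE; apply: cvg_series_sum => j.
by rewrite mulrC; apply: cvg_series_scale; exact: cvg_expmx_entry.
Qed.

Lemma exprZ_mx (m : nat) (a : R) (A : 'M[R]_m) (k : nat) :
  (a *: A) ^+ k = a ^+ k *: A ^+ k.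
Proof.
elim: k => [|k IH]; first by rewrite !expr0 scale1r.
by rewrite !exprS IH -[LHS]scalemxAl -scalemxAr scalerA.
Qed.

(** The two sides are limits of the same series, since the traces of the powers
    agree term by term. *)
Lemma heat_character_spectral (n m m' : nat) (e : rel 'I_n) (S : {set 'I_n})
    (mu : 'I_m -> R) (nu : 'I_m' -> R)
    (tr_mu : forall k, \tr (Msym R e S ^+ k) = \sum_i mu i ^+ k)
    (tr_nu : forall k, \tr (loop_laplacian R e S ^+ k) = \sum_i nu i ^+ k) (t : R) :
  heat_character e S t = \sum_i expR (- t * mu i) - \sum_i expR (- t * nu i).
Proof.
apply: cvg_unique (@cvg_trace_expmx _ _ _) _; first exact: Rhausdorff.
rewrite (_ : (fun k => _) = (fun k => \sum_i exp_coeff (- t * mu i) k) -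
    (fun k => \sum_i exp_coeff (- t * nu i) k)); last first.
  apply/funext => k; rewrite fctE exprZ_mx -scalemxAl mxtraceZ trace_lift_swap.
  rewrite tr_mu tr_nu mulrA !mulrBr !mulr_sumr.
  congr (_ - _); apply: eq_bigr => i _;
  by rewrite /exp_coeff /= exprMn mulrC mulrA mulrC mulrA.
rewrite seriesD seriesN.
by apply: cvgB; apply: cvg_series_sum => i; exact: is_cvg_series_exp_coeff.
Qed.

End ExponentialSeries.

(** * Laplace transform and logarithmic derivative *)

Section Laplace.
Variable (R : realType).

(** Up to the factor [a], the integrand is the density of the exponential
    distribution of rate [a]. *)
Lemma integrable_exp (a : R) (a_gt0 : 0 < a) :
  (@lebesgue_measure R).-integrable `[0, +oo[ (fun t => (expR (- a * t))%:E).
Proof.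
have : (@lebesgue_measure R).-integrable `[0, +oo[
    (fun t => (a * expR (- a * t))%:E).
  apply/integrable_mkcond => //; rewrite restrict_EFin.
  exact: integrable_exponential_pdf.
move=> int_a; apply: eq_integrable (integrableZl _ a^-1 int_a) => // t _ /=.
by rewrite -EFinM mulKf ?gt_eqF.
Qed.

Lemma integral_exp (a : R) (a_gt0 : 0 < a) :
  (\int[@lebesgue_measure R]_(t in `[0%R, +oo[) (expR (- a * t))%:E = (a^-1)%:E)%E.
Proof.
have : (\int[@lebesgue_measure R]_(t in `[0%R, +oo[) (a * expR (- a * t))%:E = 1)%E.
  by rewrite integral_mkcond restrict_EFin integral_exponential_pdf.
under eq_integral do rewrite EFinM.
rewrite integralZl //; last exact: integrable_exp.
move=> ah; have : (a^-1%:E * (a%:E * \int[@lebesgue_measure R]_(t in `[0%R, +oo[)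
    (expR (- a * t))%:E) = a^-1%:E * 1)%E by rewrite ah.
by rewrite muleA -EFinM mulVf ?gt_eqF // mul1e mule1.
Qed.

Lemma laplace_exp_sum (m : nat) (l : 'I_m -> R) (p : R) (p_gt0 : 0 < p)
    (l_ge0 : forall i, 0 <= l i) :
  (@lebesgue_measure R).-integrable `[0, +oo[
    (fun t => (\sum_i expR (- (p + l i) * t))%:E) /\
  (\int[@lebesgue_measure R]_(t in `[0%R, +oo[) (\sum_i expR (- (p + l i) * t))%:E
   = (\sum_i (p + l i)^-1)%:E)%E.
Proof.
have pl_gt0 i : 0 < p + l i by rewrite ltr_wpDr.
have int i := integrable_exp (pl_gt0 i).
have sumE : (fun t => (\sum_i expR (- (p + l i) * t))%:E) =
    (fun t => (\sum_i (expR (- (p + l i) * t))%:E)%E).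
  by apply/funext => t; rewrite sumEFin.
rewrite sumE; split; first by apply: integrable_sum => // i _; exact: int.
rewrite integral_sum // -sumEFin; apply: eq_bigr => i _.
exact: integral_exp.
Qed.

Lemma ln_prod (m : nat) (f : 'I_m -> R) (f_gt0 : forall i, 0 < f i) :
  ln (\prod_i f i) = \sum_i ln (f i).
Proof.
have [] // : ln (\prod_i f i) = \sum_i ln (f i) /\ 0 < \prod_i f i.
elim/big_rec2: _ => [|i x y _ [<- y_gt0]]; first by rewrite ln1 ltr01.
by rewrite lnM ?posrE // mulr_gt0.
Qed.

Lemma is_derive_ln_prod (m : nat) (l : 'I_m -> R) (p : R) (p_gt0 : 0 < p)
    (l_ge0 : forall i, 0 <= l i) :
  is_derive p 1 (fun q => ln (\prod_i (q + l i))) (\sum_i (p + l i)^-1).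
Proof.
have shift_gt0 q i : 0 < q -> 0 < q + l i by move=> ?; rewrite ltr_wpDr.
have term i : is_derive p 1 (fun q : R => ln (q + l i)) (p + l i)^-1.
  have h := is_derive1_ln (shift_gt0 p i p_gt0).
  have := @is_derive1_comp R (@ln R) (shift (l i)) p _ _ h (is_derive_shift _ _ _).
  by rewrite mulr1.
apply: near_eq_is_derive (is_derive_sum term).
near=> q; rewrite fct_sumE ln_prod // => i; apply: shift_gt0.
near: q; exact: lt_nbhsr.
Unshelve. all: by end_near. Qed.
End Laplace.

Unset Implicit Arguments.

Theorem theorem5p8 (R : realType) (N : nat) (e : rel 'I_N) (S : {set 'I_N})
    (e_sym : symmetric e) (e_irr : irreflexive e) (S_gt0 : (1 <= #|S|)%N)
    (p : R) (p_gt0 : 0 < p) :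
  let sigma : R := #|S|%:R in
  let F : R -> R := fun q => q + 2 * sigma - 2 * loop_resolvent e S q in
  [/\ p%:M + loop_laplacian R e S \in unitmx,
      0 < F p,
      (@lebesgue_measure R).-integrable `[0, +oo[
        (fun t : R => (expR (- p * t) * heat_character e S t)%:E),
      derivable (fun q : R => ln (F q)) p 1 &
      (\int[@lebesgue_measure R]_(t in `[0%R, +oo[)
         (expR (- p * t) * heat_character e S t)%:E
       = (derive1 (fun q : R => ln (F q)) p)%:E)%E] /\
  \det (p%:M + Msym R e S) / \det (p%:M + loop_laplacian R e S)
  = p + 2 * sigma
    - 2 * ((loopvec R S)^T *m invmx (p%:M + loop_laplacian R e S)
             *m loopvec R S) 0 0.
Proof.
move=> sigma F.
have [mu [mu_ge0 tr_mu det_mu]] :=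
  compression_spectrum e_sym (Msym_compression R e S).
have [nu [nu_ge0 tr_nu det_nu]] :=
  compression_spectrum e_sym (loop_laplacian_compression R e S).
have prod_gt0 m (l : 'I_m -> R) q :
    (forall i, 0 <= l i) -> 0 < q -> 0 < \prod_i (q + l i).
  by move=> l_ge0 q_gt0; apply: prodr_gt0 => i _; rewrite ltr_wpDr.
have unit q : 0 < q -> q%:M + loop_laplacian R e S \in unitmx.
  by move=> q_gt0; rewrite unitmxE det_nu unitfE gt_eqF // prod_gt0.
have FE q : 0 < q -> F q = \prod_i (q + mu i) / \prod_i (q + nu i).
  by move=> q_gt0; rewrite -det_mu -det_nu det_Msym_ratio // unit.
have heatE t : expR (- p * t) * heat_character e S t =
    \sum_i expR (- (p + mu i) * t) - \sum_i expR (- (p + nu i) * t).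
  rewrite (heat_character_spectral tr_mu tr_nu).
  rewrite mulrBr !mulr_sumr; congr (_ - _); apply: eq_bigr => i _;
  by rewrite -expRD; congr expR; ring.
have [int_mu L_mu] := laplace_exp_sum p_gt0 mu_ge0.
have [int_nu L_nu] := laplace_exp_sum p_gt0 nu_ge0.
(* [F] is the quotient of the products only where [q > 0], hence near [p]. *)
have dF : is_derive p 1 (fun q => ln (F q))
    (\sum_i (p + mu i)^-1 - \sum_i (p + nu i)^-1).
  apply: near_eq_is_derive (is_deriveB (is_derive_ln_prod p_gt0 mu_ge0)
    (is_derive_ln_prod p_gt0 nu_ge0)).
  near=> q; have q_gt0 : 0 < q by near: q; exact: lt_nbhsr.
  by rewrite FE // ln_div ?posrE ?prod_gt0.
split; last by rewrite det_Msym_ratio // unit.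
split.
- exact: unit.
- by rewrite FE // divr_gt0 // prod_gt0.
- apply: eq_integrable (integrableB _ int_mu int_nu) => // t _.
  by rewrite heatE EFinB.
- by have [] := dF.
rewrite derive1E derive_val.
under eq_integral do rewrite heatE EFinB.
rewrite integralB_EFin //.
by rewrite L_mu L_nu -EFinB.
Unshelve. all: by end_near. Qed.
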